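(* Let the data $A,B_1,B_2,C,D$ and $F_1,\dots,F_M$ satisfy the two standing assumptions in the context, and let $\widehat\varphi_1,\zeta,\pi$ be as defined there. Let $\bar s_2\in\mathrm{ri}(\mathrm{dom}(\widehat\varphi_1))$ be a stationary point of the problem $\min_{s_2\in\mathbb{R}^{mn}}\zeta(s_2)$, i.e. $0\in\partial\zeta(\bar s_2)$. Then $\bar s_2$ is a local minimizer of $\zeta$. Moreover, there exists $\omega_{\bar s_2}\subseteq[st]$ such that $\bar s_2$ is a global minimizer of $$\min_{s_2\in\mathbb{R}^{mn}}\ \widehat\varphi_1(s_2)\quad\text{s.t.}\quad[\pi(s_2)]_i=0\ \ \forall i\in[st]\setminus\omega_{\bar s_2}.$$
   Context: Data. $A\in\mathbb{R}^{n\times n}$, $B_2\in\mathbb{R}^{n\times m}$, $B_1\in\mathbb{R}^{n\times l}$, $C\in\mathbb{R}^{q\times n}$, $D\in\mathbb{R}^{q\times m}$ are the matrices of the system $\dot x=Ax+B_2u+B_1w$, $z=Cx+Du$; $p=m+n$; $\gamma>0$. Partitions $m=m_1+\dots+m_s$ and $n=n_1+\dots+n_t$ are fixed. Standing assumption 1: $C^\top D=0$, $D^\top D\succ0$, $C^\top C\succ0$, $B_1B_1^\top\succ0$, $(A,B_2)$ is stabilizable, and $(A,C)$ has no unobservable modes on the imaginary axis. Standing assumption 2: $F=\begin{pmatrix}A&-B_2\\0&0\end{pmatrix}\in\mathbb{R}^{p\times p}$ is unknown but is a convex combination $F=\sum_{i=1}^M\xi_iF_i$, $\xi_i\ge0$,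 $\sum_i\xi_i=1$, of given matrices $F_i=\begin{pmatrix}A_i&-B_{2,i}\\0&0\end{pmatrix}\in\mathbb{R}^{p\times p}$. Matrices: $Q=\begin{pmatrix}B_1B_1^\top&0\\0&0\end{pmatrix}$, $R=\begin{pmatrix}C^\top C&0\\0&D^\top D\end{pmatrix}\in\mathbb{S}^p$, $V_1=[\mathbf 0_{m\times n},I_m]$, $V_2=[I_n,\mathbf 0_{n\times m}]$. For $W\in\mathbb{R}^{p\times p}$ let $W_1$ denote its leading $n\times n$ block, partitioned into blocks of size $n_a\times n_b$. With $N=t(t-1)/2$, the matrices $V_{j1},V_{j2}$ ($j\in[N]$) are the $0$-$1$ selection matrices such that $V_{j1}WV_{j2}$, $j\in[N]$, enumerates the blocks $(W_1)_{ab}$, $1\le a<b\le t$. Set $$\widehat{\mathcal A}=\begin{pmatrix} V_{12}^\top\otimes V_{11} \\ \vdots \\ V_{N2}^\top\otimes V_{N1} \end{pmatrix}\in\mathbb{R}^{N^*\times p^2},\quad \mathcal{A}=\begin{pmatrix} \widehat{\mathcal A} \\ V_2\otimes V_1 \end{pmatrix}\in\mathbb{R}^{(N^*+mn)\times p^2},\quad U=\begin{pmatrix} \mathbf 0_{N^*\times mn} \\ I_{mn} \end{pmatrix},$$ where $N^*=\sum_{a<b}n_an_b$ is the number of rows of $\widehat{\mathcal A}$. Functions: $\mathrm{vec}$ stacks columns; $\mathbb{S}^k_+$ is the set of symmetric positive semidefinite $k\times k$ matrices; $\Gamma_+^k=\{\mathrm{vec}(X):X\in\mathbb{S}_+^k\}$;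 $\delta_S$ is the indicator function of $S$. For $\widetilde W=\mathrm{vec}(W)\in\mathbb{R}^{p^2}$ let $\widetilde\Psi_i=\mathrm{vec}\big(-V_2(F_iW+WF_i^\top+Q)V_2^\top\big)$, and $$f(\widetilde W)=\langle\mathrm{vec}(R),\widetilde W\rangle+\delta_{\Gamma_+^p}(\widetilde W)+\sum_{i=1}^M\delta_{\Gamma_+^n}(\widetilde\Psi_i).$$ For $s_2=\mathrm{vec}(P)\in\mathbb{R}^{mn}$ with $P\in\mathbb{R}^{m\times n}$ partitioned into blocks $P_{ij}\in\mathbb{R}^{m_i\times n_j}$, $\pi(s_2)\in\{0,1\}^{st}$ has entry with index $i+s(j-1)$ equal to $1$ if $P_{ij}\ne0$ and $0$ if $P_{ij}=0$; $\|\cdot\|_0$ counts nonzero entries. For $s_2\in\mathbb{R}^{mn}$ define $$\widehat\varphi_1(s_2)=\inf\{f(\widetilde W):\mathcal{A}\widetilde W=Us_2\},\qquad\widehat\varphi_2(s_2)=\gamma\|\pi(s_2)\|_0,\qquad\zeta=\widehat\varphi_1+\widehat\varphi_2 .$$ $[st]=\{1,\dots,st\}$; $\mathrm{dom}$ is the effective domain; $\mathrm{ri}$ is the relative interior; $\partial$ is the limiting (Mordukhovich) subdifferential. *)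

(* Defs.v *)
From HB Require Import structures.
From mathcomp Require Import all_boot all_order all_algebra.
From mathcomp Require Import all_classical all_reals all_analysis.
From mathcomp Require Import complex mxtens.
Set Implicit Arguments.
Unset Strict Implicit.
Unset Printing Implicit Defensive.
Import Order.TTheory GRing.Theory Num.Theory.
Import numFieldNormedType.Exports.
Local Open Scope classical_set_scope.
Local Open Scope ring_scope.

(* A partitioned dimension is, by definition, the sum of its
   block sizes, so that [submxblock] applies without any cast. *)
Notation bdim k_ := (\sum_i k_ i)%N.

Local Notation "A *t B" := (tensmx A B)
  (at level 40, left associativity, format "A  *t  B").

Section Matrices.
Context {R : realType}.

Definition inner d (u v : 'cV[R]_d) : R := \sum_i u i 0 * v i 0.

(* Column stacking: entry (i, j) of an a x b matrix goes to position j * a + i,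
   which is also the index convention of the Kronecker product [tensmx]. *)
Definition vec a b (X : 'M[R]_(a, b)) : 'cV[R]_(b * a) :=
  \col_k X (mxtens_unindex k).2 (mxtens_unindex k).1.

Definition unvec a b (x : 'cV[R]_(b * a)) : 'M[R]_(a, b) :=
  \matrix_(i, j) x (mxtens_index (j, i)) 0.

Lemma vecK a b : cancel (@vec a b) (@unvec a b).
Proof. by move=> X; apply/matrixP => i j; rewrite !mxE mxtens_indexK. Qed.

Lemma unvecK a b : cancel (@unvec a b) (@vec a b).
Proof.
by move=> x; apply/colP => k; rewrite !mxE -surjective_pairing mxtens_unindexK.
Qed.

Lemma vec_mulmx a c d b (A : 'M[R]_(a, c)) (X : 'M[R]_(c, d))
    (B : 'M[R]_(d, b)) :
  vec (A *m X *m B) = (B^T *t A) *m vec X.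
Proof.
apply/colP => k; rewrite !mxE.
under eq_bigr => j _ do rewrite mxE big_distrl /=.
rewrite pair_big /= (reindex (@mxtens_unindex d c)) /=; last first.
  by exists (@mxtens_index d c) => i _; rewrite ?mxtens_indexK ?mxtens_unindexK.
apply: eq_bigr => i _; rewrite !mxE.
by rewrite mulrC mulrA.
Qed.

Definition psd k (X : 'M[R]_k) : Prop :=
  X^T = X /\ forall x : 'cV[R]_k, 0 <= (x^T *m X *m x) 0 0.

Definition pd k (X : 'M[R]_k) : Prop :=
  X^T = X /\ forall x : 'cV[R]_k, x != 0 -> 0 < (x^T *m X *m x) 0 0.

Definition vec_psd k : set 'cV[R]_(k * k) := [set vec X | X in @psd k].

Local Notation toC := (map_mx (real_complex R)).

Definition hurwitz n (A : 'M[R]_n) : Prop :=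
  forall lam : R[i], eigenvalue (toC A) lam -> complex.Re lam < 0.

Definition stabilizable n m (A : 'M[R]_n) (B : 'M[R]_(n, m)) : Prop :=
  exists K : 'M[R]_(m, n), hurwitz (A + B *m K).

Definition unobservable_mode n q (A : 'M[R]_n) (C : 'M[R]_(q, n))
    (lam : R[i]) : Prop :=
  exists v : 'cV[R[i]]_n,
    [/\ v != 0, toC A *m v = lam *: v & toC C *m v = 0].

Definition no_imaginary_unobservable_mode n q (A : 'M[R]_n)
    (C : 'M[R]_(q, n)) : Prop :=
  forall lam : R[i], complex.Re lam = 0 -> ~ unobservable_mode A C lam.

End Matrices.

Section VariationalAnalysis.
Context {R : realType}.
Local Open Scope ereal_scope.

Definition delta T (S : set T) (x : T) : \bar R :=
  if `[< S x >] then 0 else +oo.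

Definition dom T (f : T -> \bar R) : set T := [set x | f x < +oo].

Definition aff_hull (V : lmodType R) (S : set V) : set V :=
  [set x | exists k (a : 'I_k -> R) (y : 'I_k -> V),
    [/\ forall i, S (y i), (\sum_i a i)%R = 1%R
      & x = (\sum_i a i *: y i)%R]].

Definition ri (V : normedModType R) (S : set V) : set V :=
  [set x | aff_hull S x /\ \forall y \near x, aff_hull S y -> S y].

(* v is a regular subgradient iff f y >= f x + <v, y - x> + o(|y - x|); the
   condition that the lower limit of the quotient be nonnegative does not depend on which norm of the
   finite-dimensional space is used. *)
Definition regular_subdiff d (f : 'cV[R]_d -> \bar R) (x : 'cV[R]_d) :
    set 'cV[R]_d :=
  [set v | f x \is a fin_num /\
    0 <= limf_einf
      (fun y => (f y - f x - (inner v (y - x))%:E) * (`|y - x|^-1)%:E) x^'].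

Definition limiting_subdiff d (f : 'cV[R]_d -> \bar R) (x : 'cV[R]_d) :
    set 'cV[R]_d :=
  [set v | f x \is a fin_num /\
    exists (x_ v_ : nat -> 'cV[R]_d),
      [/\ x_ @ \oo --> x, f \o x_ @ \oo --> f x,
          forall k, regular_subdiff f (x_ k) (v_ k) & v_ @ \oo --> v]].

Definition local_minimizer d (f : 'cV[R]_d -> \bar R) (x : 'cV[R]_d) : Prop :=
  \forall y \near x, f x <= f y.

Definition global_minimizer_on d (f : 'cV[R]_d -> \bar R) (S : set 'cV[R]_d)
    (x : 'cV[R]_d) : Prop :=
  S x /\ forall y, S y -> f x <= f y.

End VariationalAnalysis.

Section Problem.
Context {R : realType} {s t : nat} {m_ : 'I_s -> nat} {n_ : 'I_t -> nat}.
Local Notation m := (bdim m_).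
Local Notation n := (bdim n_).
Local Notation p := (n + m)%N.

Definition Fmx (A : 'M[R]_n) (B2 : 'M[R]_(n, m)) : 'M[R]_p :=
  block_mx A (- B2) 0 0.

Definition Qmx l (B1 : 'M[R]_(n, l)) : 'M[R]_p := block_mx (B1 *m B1^T) 0 0 0.

Definition Rmx q (C : 'M[R]_(q, n)) (D : 'M[R]_(q, m)) : 'M[R]_p :=
  block_mx (C^T *m C) 0 0 (D^T *m D).

Definition V1 : 'M[R]_(m, p) := row_mx 0 1%:M.
Definition V2 : 'M[R]_(n, p) := row_mx 1%:M 0.

Definition npairs := (t * t.-1)./2.

(* [e] lists, in an arbitrary order and without repetition, the index pairs
   (a, b) with a < b of the strictly upper blocks. *)
Definition enum_upper (e : 'I_npairs -> 'I_t * 'I_t) : Prop :=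
  injective e /\ forall a b : 'I_t, (a < b)%N <-> exists j, e j = (a, b).

Definition selmx (a : 'I_t) : 'M[R]_(n_ a, n) :=
  \matrix_(i, k) (k == tagnat.Rank a i)%:R.

Lemma mul_selmx a k (X : 'M[R]_(n, k)) :
  selmx a *m X = rowsub (tagnat.Rank a) X.
Proof.
apply/matrixP => i c; rewrite !mxE (bigD1 (tagnat.Rank a i)) //=.
rewrite [X in _ + X]big1 => [|c' /negPf ci]; last by rewrite !mxE ci mul0r.
by rewrite !mxE eqxx mul1r addr0.
Qed.

Lemma mul_selmx_tr a k (X : 'M[R]_(k, n)) :
  X *m (selmx a)^T = colsub (tagnat.Rank a) X.
Proof.
by apply: trmx_inj; rewrite trmx_mul trmxK mul_selmx trmx_mxsub.
Qed.

Section Constraint.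
Variable e : 'I_npairs -> 'I_t * 'I_t.

Definition Vj1 j : 'M[R]_(n_ (e j).1, p) := row_mx (selmx (e j).1) 0.
Definition Vj2 j : 'M[R]_(p, n_ (e j).2) := (row_mx (selmx (e j).2) 0)^T.

Lemma Vj1_Vj2 (W : 'M[R]_p) j :
  Vj1 j *m W *m Vj2 j = submxblock (ulsubmx W) (e j).1 (e j).2.
Proof.
rewrite /Vj1 /Vj2 -{1}[W]submxK tr_row_mx mul_row_block mul_row_col trmx0.
rewrite mulmx0 !mul0mx !addr0 mul_selmx mul_selmx_tr.
by apply/matrixP => i k; rewrite !mxE.
Qed.

Definition Nstar := (\sum_(j < npairs) n_ (e j).2 * n_ (e j).1)%N.

Definition Ahat : 'M[R]_(Nstar, p * p) :=
  \mxcol_(j < npairs) ((Vj2 j)^T *t Vj1 j).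

Definition Acal : 'M[R]_(Nstar + n * m, p * p) := col_mx Ahat (V2 *t V1).

Definition Umx : 'M[R]_(Nstar + n * m, n * m) := col_mx 0 1%:M.

End Constraint.

Definition Psi l (B1 : 'M[R]_(n, l)) (F W : 'M[R]_p) : 'M[R]_n :=
  - (V2 *m (F *m W + W *m F^T + Qmx B1) *m V2^T).

Local Open Scope ereal_scope.

Definition fobj l q M (B1 : 'M[R]_(n, l)) (C : 'M[R]_(q, n))
    (D : 'M[R]_(q, m)) (F_ : 'I_M -> 'M[R]_p) (w : 'cV[R]_(p * p)) : \bar R :=
  (inner (vec (Rmx C D)) w)%:E + delta (@vec_psd R p) w
  + \sum_(i < M) delta (@vec_psd R n) (vec (Psi B1 (F_ i) (unvec w))).

Definition phi1 e l q M (B1 : 'M[R]_(n, l)) (C : 'M[R]_(q, n))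
    (D : 'M[R]_(q, m)) (F_ : 'I_M -> 'M[R]_p) (s2 : 'cV[R]_(n * m)) : \bar R :=
  ereal_inf [set fobj B1 C D F_ w
            | w in [set w | Acal e *m w = Umx e *m s2]].

(* Block (i, j) has position j * s + i. *)
Definition bpi (s2 : 'cV[R]_(n * m)) : 'cV[R]_(t * s) :=
  \col_k (submxblock (unvec s2 : 'M[R]_(m, n))
            (mxtens_unindex k).2 (mxtens_unindex k).1 != 0)%:R%R.

Definition l0norm d (x : 'cV[R]_d) : nat := #|[set i | x i 0%R != 0%R]%SET|.

Definition phi2 (gamma : R) (s2 : 'cV[R]_(n * m)) : \bar R :=
  (gamma * (l0norm (bpi s2))%:R)%:E.

Definition zeta e l q M (B1 : 'M[R]_(n, l)) (C : 'M[R]_(q, n))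
    (D : 'M[R]_(q, m)) (F_ : 'I_M -> 'M[R]_p) (gamma : R)
    (s2 : 'cV[R]_(n * m)) : \bar R :=
  phi1 e B1 C D F_ s2 + phi2 gamma s2.

Local Close Scope ereal_scope.

Definition standing1 l q (A : 'M[R]_n) (B1 : 'M[R]_(n, l)) (B2 : 'M[R]_(n, m))
    (C : 'M[R]_(q, n)) (D : 'M[R]_(q, m)) : Prop :=
  [/\ C^T *m D = 0, pd (D^T *m D) & pd (C^T *m C)] /\
  [/\ pd (B1 *m B1^T), stabilizable A B2
    & no_imaginary_unobservable_mode A C].

Definition standing2 M (A : 'M[R]_n) (B2 : 'M[R]_(n, m))
    (A_ : 'I_M -> 'M[R]_n) (B2_ : 'I_M -> 'M[R]_(n, m)) : Prop :=
  exists xi : 'I_M -> R,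
    [/\ forall i, 0 <= xi i, \sum_i xi i = 1
      & Fmx A B2 = \sum_i xi i *: Fmx (A_ i) (B2_ i)].

End Problem.

(* Main.v *)
Require Import Defs.
From HB Require Import structures.
From mathcomp Require Import all_boot all_order all_algebra.
From mathcomp Require Import all_classical all_reals all_analysis.
From mathcomp Require Import mxtens ring lra.
Import Order.TTheory GRing.Theory Num.Theory.
Import numFieldNormedType.Exports.
Local Open Scope classical_set_scope.
Local Open Scope ring_scope.

(** The objective is a convex function [f] (the value function of a convex
    program) plus [gamma] times the number of nonzero blocks of the argument.
    Let [S] be the space of points whose block support lies in that of [sbar].

    Two semicontinuity facts hold near [sbar].  The block support can only
    grow, and [f], being convex and finite at a point of [ri (dom f)], is lower
    semicontinuous there ([econvex_lsc_ri]).  Hence along the sequence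
    [x_k --> sbar] given by the limiting subgradient, where the objective
    converges, the penalty cannot exceed its value at [sbar] by a full
    [gamma]: the support of [x_k] is eventually exactly that of [sbar].  A
    regular subgradient [v_k] of the objective at such an [x_k] is tested only
    along segments towards points of [S], on which the penalty does not
    increase; convexity then turns the local inequality into the affine
    minorant [f x_k + <v_k, y - x_k> <= f y] for all [y] in [S]
    ([regular_subgradient_minorant]).  Letting [k] grow, with [v_k --> 0] and
    lower semicontinuity once more, gives [f sbar <= f y]: this is global
    minimality on [S].

    Local minimality of the full objective follows: a nearby [y] either has
    the support of [sbar], hence lies in [S], or pays at least one more
    [gamma], which outweighs the small possible decrease of [f]
    ([stationary_support_penalized]). *)

(** * Extended-real convex functions *)

(** Convexity of the epigraph.  Real upper bounds [a], [b] replace the values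
    of [f], so that no indeterminate sum of opposite infinities arises. *)
Definition econvex {R : realType} {V : lmodType R} (f : V -> \bar R) : Prop :=
  forall (x y : V) (a b t : R), 0 <= t <= 1 ->
    (f x <= a%:E)%E -> (f y <= b%:E)%E ->
    (f (t *: x + (1 - t) *: y)%R <= (t * a + (1 - t) * b)%:E)%E.

(** Jensen's inequality with unnormalized weights.  The point [y] of weight [1]
    is kept apart so that the total weight never vanishes. *)
Lemma econvex_jensen {R : realType} {V : lmodType R} {f : V -> \bar R}
    {n : nat} {w b : 'I_n -> R} {z : 'I_n -> V} {y : V} {a : R} :
  econvex f -> (f y <= a%:E)%E ->
  (forall i, 0 <= w i) -> (forall i, (f (z i) <= (b i)%:E)%E) ->
  (f ((1 + \sum_i w i)^-1 *: (y + \sum_i w i *: z i))%R <=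
    ((1 + \sum_i w i)^-1 * (a + \sum_i w i * b i))%:E)%E.
Proof.
move=> cf fy; elim: n w b z => [|n IHn] w b z w0 fz.
  by rewrite !big_ord0 !addr0 invr1 scale1r mul1r.
rewrite !big_ord_recr /=.
have /IHn : forall i, 0 <= w (widen_ord (leqnSn n) i) by [].
move=> /(_ (fun i => b (widen_ord (leqnSn n) i))
  (fun i => z (widen_ord (leqnSn n) i)) (fun i => fz _)).
have : 0 <= \sum_i w (widen_ord (leqnSn n) i) by exact: sumr_ge0.
set S := \sum_i _; set X := \sum_i _ *: _; set B := \sum_i _ * _ => S0 fX.
have wn := w0 ord_max; set u := w ord_max in wn *.
have SP : 0 < 1 + S by lra.
have SuP : 0 < 1 + (S + u) by lra.
have t01 : 0 <= (1 + S) / (1 + (S + u)) <= 1.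
  by rewrite divr_ge0 ?(ltW SP) ?(ltW SuP) //= ler_pdivrMr //; lra.
have Et : 1 - (1 + S) / (1 + (S + u)) = (1 + (S + u))^-1 * u.
  by field; apply: lt0r_neq0.
have := cf _ _ _ _ _ t01 fX (fz ord_max); rewrite Et.
set P := 1 + S; set T := 1 + (S + u).
have -> : P / T *: (P^-1 *: (y + X)) + (T^-1 * u) *: z ord_max =
    T^-1 *: (y + (X + u *: z ord_max)).
  rewrite scalerA mulrAC divff ?lt0r_neq0 // mul1r -[(_ * u) *: _]scalerA.
  by rewrite -scalerDr addrA.
congr (_ <= _%:E)%E.
by rewrite /P /T; field; rewrite !lt0r_neq0.
Qed.

(** Take the [u i] to be a maximal free family in [L]: by maximality it spans
    [L], even when [L] is not a subspace.  The coordinates are given by a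
    matrix, hence depend continuously on the point. *)
Lemma spanning_family {R : realType} {d : nat} (L : set 'cV[R]_d) :
  exists k (u : 'I_k -> 'cV[R]_d) (K : 'M[R]_(k, d)),
    (forall i, L (u i)) /\
    forall x, L x -> x = \sum_i (K *m x) i 0 *: u i.
Proof.
pose P k := `[< exists U : 'M[R]_(k, d),
  row_free U /\ forall i, L (row i U)^T >].
have P0 : exists k, P k.
  exists 0%N; apply/asboolP; exists 0; split; last by case.
  by rewrite /row_free mxrank0.
have Pd k : P k -> (k <= d)%N.
  by move=> /asboolP[U [/eqP Ufree _]]; rewrite -{1}Ufree rank_leq_col.
case: (ex_maxnP P0 Pd) => k /asboolP[U [Ufree LU]] kmax.
exists k, (fun i => (row i U)^T), (pinvmx U)^T; split=> // x Lx.
have xU : (x^T <= U)%MS.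
  apply: contraT => xU; suff /kmax : P k.+1 by rewrite ltnn.
  rewrite -addn1; apply/asboolP; exists (col_mx U x^T); split; last first.
    move=> i; rewrite -(splitK i); case: (fintype.split i) => j /=.
      by rewrite rowKu.
    by rewrite rowKd row_id trmxK.
  rewrite /row_free eqn_leq rank_leq_row /= -addsmxE.
  have : (U < U + x^T)%MS by rewrite ltmxE addsmxSl addsmx_sub submx_refl.
  by move=> /rank_ltmx; rewrite (eqP Ufree) addn1.
apply: trmx_inj; rewrite -[LHS](mulmxKpV xU) mulmx_sum_row.
rewrite raddf_sum /=; apply: eq_bigr => i _.
by rewrite linearZ /= trmxK -[x in RHS]trmxK -trmx_mul [RHS]/= [in RHS]mxE.
Qed.

(** The line through [x] and [y] lies in the affine hull of [S], so near [x]
    it stays in [S], on the far side of [x] as well. *)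
Lemma ri_segment {R : realType} {V : normedModType R} {S : set V} {x y : V} :
  ri S x -> S y ->
  exists2 r : R, 0 < r & forall c, `|c| <= r -> S (x + c *: (y - x)).
Proof.
move=> [xS nS] yS; have Sx : S x by exact: (nbhs_singleton nS).
have : x + c *: (y - x) @[c --> (0 : R)] --> x + 0 *: (y - x).
  by apply: cvgD; [exact: cvg_cst|apply: cvgZr_tmp; exact: cvg_id].
rewrite scale0r addr0.
move=> /(_ _ nS) /nbhs_norm0P[r /= r0 rS].
exists (r / 2) => [|c cr]; first by rewrite divr_gt0.
apply: (rS c) => /=; first by rewrite (le_lt_trans cr) // ltr_pdivrMr //; lra.
exists 2%N, (fun i : 'I_2 => if i == 0 then 1 - c else c),
  (fun i : 'I_2 => if i == 0 then x else y); split.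
- by move=> i; case: ifP.
- by rewrite !big_ord_recl big_ord0 /=; lra.
- rewrite !big_ord_recl big_ord0 /= addr0 scalerBr scalerBl scale1r.
  by rewrite addrA addrAC.
Qed.

(** * Lower semicontinuity in the relative interior *)

Lemma cvg_inner {R : realType} {d : nat} {T : Type} {F : set_system T}
    {FF : Filter F} {g h : T -> 'cV[R]_d} {a b : 'cV[R]_d} :
  g @ F --> a -> h @ F --> b ->
  inner (g x) (h x) @[x --> F] --> inner a b.
Proof.
move=> ga hb; apply: cvg_big => [|i _]; first exact: add_continuous.
apply: cvgM.
- apply: (@cvg_comp _ _ _ g (fun v : 'cV[R]_d => v i 0)); first exact: ga.
  exact: coord_continuous.
- apply: (@cvg_comp _ _ _ h (fun v : 'cV[R]_d => v i 0)); first exact: hb.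
  exact: coord_continuous.
Qed.

Lemma le_real_upper_bound {R : realType} {u v : \bar R} :
  (forall a : R, (v <= a%:E)%E -> (u <= a%:E)%E) -> (u <= v)%E.
Proof.
case: v => [r||] uv; first exact: uv.
  exact: leey.
rewrite leeNy_eq; case: u uv => [r||] // uv.
- by have := uv (r - 1) (leNye _); rewrite lee_fin; lra.
- by have := uv 0 (leNye _).
Qed.

Lemma lty_real_upper_bound {R : realType} {u : \bar R} :
  (u < +oo)%E -> exists a : R, (u <= a%:E)%E.
Proof. by case: u => [r||] // _; [exists r | exists 0; rewrite leNye]. Qed.

(** Choose points [x +- r_i u_i] of the domain, on both sides of [x], in
    directions [u_i] that span [dom f - x].  For [y] in the domain write
    [y - x = \sum_i c_i u_i]; then [x] is the weighted mean of [y], with weight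
    [1], and of the points [x - sgn(c_i) r_i u_i], with weights [|c_i| / r_i].
    Jensen's inequality bounds [f y] from below by [f x] plus a combination of
    those weights, which vanishes as [y] tends to [x]. *)
Lemma econvex_lsc_ri {R : realType} {d : nat} {f : 'cV[R]_d -> \bar R}
    {x : 'cV[R]_d} {eps : R} :
  econvex f -> ri (dom f) x -> f x \is a fin_num -> 0 < eps ->
  \forall y \near x, (f x - eps%:E <= f y)%E.
Proof.
move=> cf rix fx eps0.
have [k [u [K [Lu Ku]]]] := spanning_family [set h | dom f (x + h)].
have /choice[rb rbP] : forall i, exists rb : R * R, [/\ 0 < rb.1,
    (f (x + rb.1 *: u i)%R <= rb.2%:E)%E
    & (f (x - rb.1 *: u i)%R <= rb.2%:E)%E].
  move=> i; have [r r0 rS] := ri_segment rix (Lu i).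
  move: rS; rewrite [x + u i]addrC addrK => rS.
  have r1 : `|r| <= r by rewrite gtr0_norm.
  have r2 : `|- r| <= r by rewrite normrN.
  have [b1 b1P] := lty_real_upper_bound (rS _ r1).
  have [b2 b2P] := lty_real_upper_bound (rS _ r2).
  exists (r, Num.max b1 b2); split => //=.
    by apply: (le_trans b1P); rewrite lee_fin le_max lexx.
  by rewrite -scaleNr; apply: (le_trans b2P); rewrite lee_fin le_max lexx orbT.
(* The c y i are the coordinates of y - x in the family u; Jensen's inequality
   will give f x + g y <= f y. *)
pose c (y : 'cV[R]_d) i := inner (row i K)^T (y - x).
pose w (y : 'cV[R]_d) i : R := `|c y i| / (rb i).1.
pose g (y : 'cV[R]_d) : R := \sum_i w y i * (fine (f x) - (rb i).2).
have gx : g y @[y --> x] --> g x.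
  apply: (cvg_big add_continuous (F := nbhs x)) => i _.
  do 2 apply: cvgMr_tmp; apply: cvg_norm.
  apply: (@cvg_inner _ _ _ (nbhs x) _ (fun=> (row i K)^T) (fun y => y - x)).
    exact: cvg_cst.
  by apply: cvgB; [exact: cvg_id|exact: cvg_cst].
have gx0 : g x = 0.
  rewrite /g big1 // => i _; rewrite /w /c subrr /inner big1 ?normr0 ?mul0r //.
  by move=> j _; rewrite [X in _ * X]mxE mulr0.
have : - eps < g x by rewrite gx0 oppr_lt0.
move=> /(cvgr_gt _ gx); apply: filterS => y gy.
apply: le_real_upper_bound => a fya.
have Ly : dom f (x + (y - x)).
  by rewrite addrC subrK /dom /= (le_lt_trans fya) ?ltry.
have yE := Ku _ Ly.
pose z i := if 0 <= c y i then x - (rb i).1 *: u i else x + (rb i).1 *: u i.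
have w0 i : 0 <= w y i.
  by have [r0 _ _] := rbP i; rewrite divr_ge0 // ltW.
have fz i : (f (z i) <= (rb i).2%:E)%E.
  by rewrite /z; have [_ ? ?] := rbP i; case: ifP.
have := econvex_jensen cf fya w0 fz.
set S := \sum_i w y i; have S0 : 0 <= S by exact: sumr_ge0.
have -> : (1 + S)^-1 *: (y + \sum_i w y i *: z i) = x.
  have -> : \sum_i w y i *: z i = S *: x - (y - x).
    rewrite yE /S scaler_suml -sumrB; apply: eq_bigr => i _.
    have -> : (K *m (y - x)) i 0 = c y i.
      by rewrite mxE; apply: eq_bigr => j _; rewrite !mxE.
    have [r0 _ _] := rbP i.
    rewrite /w /z; case: lerP => c0.
      rewrite scalerBr scalerA ger0_norm // divfK ?lt0r_neq0 //.
    by rewrite scalerDr scalerA ltr0_norm // divfK ?lt0r_neq0 // scaleNr.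
  have -> : y + (S *: x - (y - x)) = (1 + S) *: x.
    by rewrite scalerDl scale1r opprB [LHS]addrC -addrA subrK addrC.
  by rewrite scalerA mulVf ?scale1r // lt0r_neq0 //; lra.
rewrite -(fineK fx) -EFinB !lee_fin ler_pdivlMl; last lra.
move: gy; rewrite /g.
under eq_bigr do rewrite mulrBr.
rewrite sumrB -mulr_suml -/S; set B := \sum_i _; nra.
Qed.

(** * Stationary points of support-penalized convex functions *)

(** On the segment from [x] to [y] the function [F] is dominated by [f + c],
    with equality at [x], so convexity bounds the difference quotient of [F]
    above by that of [f] between [x] and [y], at every scale, while the
    subgradient bounds it below in the limit. *)
Lemma regular_subgradient_minorant {R : realType} {d : nat}
    {f F : 'cV[R]_d -> \bar R} {x y v : 'cV[R]_d} {c : R} :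
  econvex f -> regular_subdiff F x v -> F x = (f x + c%:E)%E ->
  (forall t : R, (0 <= t <= 1)%R ->
    F (x + t *: (y - x))%R <= f (x + t *: (y - x))%R + c%:E)%E ->
  (f x + (inner v (y - x))%:E <= f y)%E.
Proof.
move=> cf [Fx_fin limF] Fx Fy.
have fx : f x \is a fin_num by move: Fx_fin; rewrite Fx fin_numD => /andP[].
have [->|yx] := eqVneq y x.
  rewrite subrr /inner big1 ?adde0 // => i _; by rewrite mxE mulr0.
have n0 : 0 < `|y - x| by rewrite normr_gt0 subr_eq0.
apply: le_real_upper_bound => b fyb.
rewrite -(fineK fx) -EFinD lee_fin.
apply/ler_addgt0Pr => e e0.
(* The quotient is compared with -e / |y - x|, so that after scaling by
   |y - x| the error is e. *)
have e1 : 0 < e / `|y - x| by rewrite divr_gt0.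
have : ((- (e / `|y - x|))%:E < 0)%E by rewrite lte_fin oppr_lt0.
move=> /lt_le_trans /(_ limF); rewrite limf_einfE.
move=> /ereal_sup_gt[_ [A /= xA <-] infA].
have : x + t *: (y - x) @[t --> (0 : R)] --> x + 0 *: (y - x).
  by apply: cvgD; [exact: cvg_cst|apply: cvgZr_tmp; exact: cvg_id].
rewrite scale0r addr0 => /(_ _ xA) /nbhs_norm0P[r /= r0 rA].
pose t := Num.min 1 (r / 2).
have t0 : 0 < t by rewrite lt_min ltr01 divr_gt0.
have t1 : t <= 1 by rewrite ge_min lexx.
have tr : t < r by rewrite gt_min; apply/orP; right; lra.
pose z := x + t *: (y - x).
have zx : z - x = t *: (y - x) by rewrite /z addrC addKr.
have Az : A z.
  apply: (rA t) => /=; first by rewrite gtr0_norm.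
  by rewrite -subr_eq0 zx scaler_eq0 subr_eq0 negb_or yx lt0r_neq0.
have t01 : 0 <= t <= 1 by rewrite ltW.
have fz : (f z <= (t * b + (1 - t) * fine (f x))%:E)%E.
  have := cf y x b (fine (f x)) t t01 fyb; rewrite fineK // => /(_ (lexx _)).
  by rewrite scalerBl scale1r addrCA -scalerBr.
have qz := lt_le_trans infA (ereal_inf_lbound (imageP _ Az)).
have : (F z - F x - (inner v (z - x))%:E <=
    (t * (b - fine (f x) - inner v (y - x)))%:E)%E.
  have -> : inner v (z - x) = t * inner v (y - x).
    rewrite zx /inner mulr_sumr; apply: eq_bigr => i _.
    by rewrite [in LHS]mxE mulrCA.
  rewrite Fx -(fineK fx) -EFinD leeBlDr // leeBlDr //.
  apply: (le_trans (Fy t t01)); apply: (le_trans (leeD2r _ fz)).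
  by rewrite -!EFinD lee_fin; lra.
have zi : (0 <= (`|z - x|^-1)%:E)%E by rewrite lee_fin.
move=> /(lee_wpmul2r zi) /(lt_le_trans qz).
rewrite -EFinM lte_fin zx normrZ gtr0_norm //.
set n := `|y - x| in n0 *; set k := b - _ - _.
have -> : t * k / (t * n) = k / n by field; rewrite !lt0r_neq0.
rewrite -mulNr ltr_pM2r ?invr_gt0 // /k => ?; lra.
Qed.

Definition support_penalized {R : realType} {d : nat} {I : finType}
    (f : 'cV[R]_d -> \bar R) (gamma : R) (supp : 'cV[R]_d -> {set I})
    (x : 'cV[R]_d) : \bar R :=
  (f x + (gamma * #|supp x|%:R)%:E)%E.

(** An abstract support is governed by two properties: moving from [y] towards
    [z] creates no index outside the two supports, so the points supported in
    [supp x] are reached along segments that stay supported there; and no index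
    of [supp x] is lost under a small perturbation. *)
Lemma stationary_support_penalized {R : realType} {d : nat} {I : finType}
    {f : 'cV[R]_d -> \bar R} {gamma : R} {supp : 'cV[R]_d -> {set I}}
    {x : 'cV[R]_d} :
  econvex f -> 0 < gamma ->
  (forall (y z : 'cV[R]_d) (t : R),
    supp (y + t *: (z - y)) \subset supp y :|: supp z) ->
  (\forall y \near x, supp x \subset supp y) ->
  ri (dom f) x -> limiting_subdiff (support_penalized f gamma supp) x 0 ->
  local_minimizer (support_penalized f gamma supp) x /\
  global_minimizer_on f [set y | supp y \subset supp x] x.
Proof.
move=> cf g0 suppD suppx rix [zx [x_ [v_ [x_x zx_ dx_ v_0]]]].
have fx : f x \is a fin_num.
  by move: zx; rewrite /support_penalized fin_numD => /andP[].
have lsc e : 0 < e -> \forall y \near x, (f x - e%:E <= f y)%E.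
  exact: econvex_lsc_ri.
have glob : global_minimizer_on f [set y | supp y \subset supp x] x.
  split => [/=|y /= suppy]; first exact: subxx.
  (* A larger support at x_k would cost gamma, while f drops by at most
     gamma / 2 and the whole objective rises by less than gamma / 2. *)
  have supp_ : \forall k \near \oo, supp (x_ k) = supp x.
    have g2 : 0 < gamma / 2 by rewrite divr_gt0.
    have lt_z : (support_penalized f gamma supp x <
        support_penalized f gamma supp x + (gamma / 2)%:E)%E.
      by rewrite lteDl // lte_fin.
    have zx_lt : \forall k \near \oo, (support_penalized f gamma supp (x_ k) <
        support_penalized f gamma supp x + (gamma / 2)%:E)%E.
      exact: (zx_ _ (open_ereal_lt' lt_z)).
    near=> k.
    have sk : supp x \subset supp (x_ k) by near: k; exact: (x_x _ suppx).
    have fk : (f x - (gamma / 2)%:E <= f (x_ k))%E.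
      by near: k; exact: (x_x _ (lsc _ _)).
    have zk : (support_penalized f gamma supp (x_ k) <
        support_penalized f gamma supp x + (gamma / 2)%:E)%E by near: k.
    apply/eqP; rewrite eq_sym eqEcard sk /=.
    rewrite leqNgt; apply/negP => ck.
    move: zk; rewrite ltNge => /negP; apply.
    rewrite /support_penalized; apply: le_trans (leeD2r _ fk).
    rewrite -(fineK fx) -!EFinD lee_fin.
    have : (#|supp x|.+1)%:R <= #|supp (x_ k)|%:R :> R by rewrite ler_nat.
    rewrite -natr1; nra.
  apply: le_real_upper_bound => b fyb.
  apply/lee_addgt0Pr => e e0.
  have e2 : 0 < e / 2 by rewrite divr_gt0.
  have inner0 : inner (v_ k) (y - x_ k) @[k --> \oo] --> inner 0 (y - x).
    apply: cvg_inner => //; apply: cvgB => //; exact: cvg_cst.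
  have inner0E : inner 0 (y - x) = 0.
    by rewrite /inner big1 // => i _; rewrite mxE mul0r.
  have : - (e / 2) < inner 0 (y - x) by rewrite inner0E oppr_lt0.
  move=> /(cvgr_gt _ inner0) in_gt.
  near \oo => k.
  have sk : supp (x_ k) = supp x by near: k.
  have fk : (f x - (e / 2)%:E <= f (x_ k))%E.
    by near: k; exact: (x_x _ (lsc _ _)).
  have ik : - (e / 2) < inner (v_ k) (y - x_ k) by near: k.
  have := regular_subgradient_minorant (y := y) (c := gamma * #|supp x|%:R)
    cf (dx_ k).
  rewrite /support_penalized sk => /(_ erefl) min_k.
  have /min_k /le_trans/(_ fyb) fkb : forall t, 0 <= t <= 1 ->
     (f (x_ k + t *: (y - x_ k))%R
       + (gamma * #|supp (x_ k + t *: (y - x_ k))%R|%:R)%:E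
      <= f (x_ k + t *: (y - x_ k))%R + (gamma * #|supp x|%:R)%:E)%E.
    move=> t _; rewrite leeD2l // lee_fin ler_pM2l // ler_nat.
    apply: subset_leq_card; apply: (fintype.subset_trans (suppD _ _ _)).
    by rewrite sk finset.subUset subxx.
  move: (le_trans (leeD2r _ fk) fkb).
  rewrite -(fineK fx) -!EFinD !lee_fin; lra.
split=> //.
near=> y.
have sy : supp x \subset supp y by near: y.
have fy : (f x - gamma%:E <= f y)%E by near: y; exact: lsc.
have [ys|/negP ys] := boolP (supp y \subset supp x).
  rewrite /support_penalized; apply: leeD; first exact: glob.2.
  by rewrite lee_fin ler_pM2l // ler_nat subset_leq_card.
rewrite /support_penalized; apply: le_trans (leeD2r _ fy).
rewrite -(fineK fx) -!EFinD lee_fin.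
have : (#|supp x|.+1)%:R <= #|supp y|%:R :> R.
  by rewrite ler_nat proper_card // properE sy; apply/negP.
rewrite -natr1; nra.
Unshelve. all: by end_near.
Qed.

(** * Convexity of the value function *)

Lemma psd_convex {R : realType} {k : nat} {X Y : 'M[R]_k} {t : R} :
  0 <= t <= 1 -> psd X -> psd Y -> psd (t *: X + (1 - t) *: Y).
Proof.
move=> /andP[t0 t1] [XT X0] [YT Y0]; split.
  by rewrite linearD !linearZ /= XT YT.
move=> x; rewrite mulmxDr mulmxDl -!scalemxAr -!scalemxAl !mxE.
rewrite addr_ge0 // mulr_ge0 ?subr_ge0 //.
  by have := X0 x; rewrite mxE.
by have := Y0 x; rewrite mxE.
Qed.

Lemma vec_psdE {R : realType} {k : nat} (X : 'M[R]_k) :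
  vec_psd (vec X) <-> psd X.
Proof.
split=> [[Y psdY]|psdX]; last by exists X.
by move=> /(can_inj (@vecK _ _ _)) <-.
Qed.

Lemma sum_delta {R : realType} {T : Type} {M : nat} (S : set T)
    (x : 'I_M -> T) :
  (\sum_(i < M) delta S (x i) =
    delta [set y | forall i, S (y i)] x :> \bar R)%E.
Proof.
have delta0 y : (0 <= delta S y :> \bar R)%E by rewrite /delta; case: ifP.
rewrite [RHS]/delta; case: asboolP => [Sx|/existsNP[i Sxi]].
  by rewrite big1 // => i _; rewrite /delta asboolT //; exact: Sx.
rewrite (bigD1 i) //= {1}/delta asboolF // addye // gt_eqF //.
by rewrite (lt_le_trans (ltNyr 0)) // sume_ge0.
Qed.

(** The sublevel sets of the objective are cut out by a linear inequality and
    semidefinite constraints, from which convexity can be read off. *)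
Lemma le_fobj {R : realType} {s t : nat} {m_ : 'I_s -> nat} {n_ : 'I_t -> nat}
    {l q M : nat} (B1 : 'M[R]_(bdim n_, l)) (C : 'M[R]_(q, bdim n_))
    (D : 'M[R]_(q, bdim m_)) (F_ : 'I_M -> 'M[R]_(bdim n_ + bdim m_)) w
    (a : R) :
  (fobj B1 C D F_ w <= a%:E)%E <->
  [/\ inner (vec (Rmx C D)) w <= a, psd (unvec w)
    & forall i, psd (Psi B1 (F_ i) (unvec w))].
Proof.
rewrite /fobj sum_delta /delta -[in vec_psd w](unvecK w).
case: asboolP => /vec_psdE w_psd; last by split=> [|[]//]; case: ifP.
case: asboolP => /= Psi_psd; last first.
  by split=> // -[_ _ P]; case: Psi_psd => i; exact/vec_psdE.
rewrite !adde0 lee_fin; split=> [|[]//] wa; split=> // i.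
exact/vec_psdE.
Qed.

Lemma Psi_affine {R : realType} {s t : nat} {m_ : 'I_s -> nat}
    {n_ : 'I_t -> nat} {l : nat} (B1 : 'M[R]_(bdim n_, l))
    (F W1 W2 : 'M[R]_(bdim n_ + bdim m_))
    (c : R) :
  Psi B1 F (c *: W1 + (1 - c) *: W2) =
    c *: Psi B1 F W1 + (1 - c) *: Psi B1 F W2.
Proof.
rewrite /Psi.
have -> : F *m (c *: W1 + (1 - c) *: W2) + (c *: W1 + (1 - c) *: W2) *m F^T
    + Qmx B1 = c *: (F *m W1 + W1 *m F^T + Qmx B1)
    + (1 - c) *: (F *m W2 + W2 *m F^T + Qmx B1).
  rewrite mulmxDr mulmxDl -!scalemxAr -!scalemxAl.
  move: (F *m W1) (F *m W2) (W1 *m _) (W2 *m _) (Qmx B1) => X1 X2 Y1 Y2 Q.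
  by apply/matrixP => i j; rewrite !mxE; ring.
rewrite [in LHS]mulmxDr [in LHS]mulmxDl -!scalemxAr -!scalemxAl.
by rewrite opprD !scalerN.
Qed.

(** A partial infimum of a jointly convex function is convex: mix
    [eps]-optimal points of the two fibres. *)
Lemma econvex_phi1 {R : realType} {s t : nat} {m_ : 'I_s -> nat}
    {n_ : 'I_t -> nat} (e : 'I_(@npairs t) -> 'I_t * 'I_t) {l q M : nat}
    (B1 : 'M[R]_(bdim n_, l)) (C : 'M[R]_(q, bdim n_))
    (D : 'M[R]_(q, bdim m_)) (F_ : 'I_M -> 'M[R]_(bdim n_ + bdim m_)) :
  econvex (phi1 e B1 C D F_).
Proof.
move=> x y a b c c01 xa yb; apply/lee_addgt0Pr => eps eps0.
have near_opt z r : (phi1 e B1 C D F_ z <= r%:E)%E ->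
    exists2 w, Acal e *m w = Umx e *m z & (fobj B1 C D F_ w <= (r + eps)%:E)%E.
  move=> zr; have : (phi1 e B1 C D F_ z < (r + eps)%:E)%E.
    by rewrite (le_lt_trans zr) // lte_fin ltrDl.
  by move=> /ereal_inf_lt[_ [w Aw <-] /ltW fw]; exists w.
have [w1 Aw1 /le_fobj[i1 psd1 Psi1]] := near_opt _ _ xa.
have [w2 Aw2 /le_fobj[i2 psd2 Psi2]] := near_opt _ _ yb.
apply: (@le_trans _ _ (fobj B1 C D F_ (c *: w1 + (1 - c) *: w2))).
  apply: ereal_inf_lbound; exists (c *: w1 + (1 - c) *: w2) => //=.
  by rewrite !mulmxDr -!scalemxAr Aw1 Aw2.
have unvecE : unvec (c *: w1 + (1 - c) *: w2) =
    c *: unvec w1 + (1 - c) *: unvec w2.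
  by apply/matrixP => i j; rewrite !mxE.
rewrite -EFinD; apply/le_fobj; rewrite unvecE; split.
- have -> : inner (vec (Rmx C D)) (c *: w1 + (1 - c) *: w2) =
      c * inner (vec (Rmx C D)) w1 + (1 - c) * inner (vec (Rmx C D)) w2.
    rewrite /inner !mulr_sumr -big_split /=; apply: eq_bigr => i _.
    by move: (vec _ i 0) => r; rewrite !mxE; ring.
  by move: c01 => /andP[]; nra.
- exact: psd_convex.
- by move=> i; rewrite Psi_affine; exact: psd_convex.
Qed.

(** * Block supports *)

Definition block_support {R : realType} {s t : nat} {m_ : 'I_s -> nat}
    {n_ : 'I_t -> nat} (x : 'cV[R]_(bdim n_ * bdim m_)) : {set 'I_(t * s)} :=
  [set k | bpi x k 0 != 0]%SET.

Lemma block_supportPn {R : realType} {s t : nat} {m_ : 'I_s -> nat}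
    {n_ : 'I_t -> nat} {x : 'cV[R]_(bdim n_ * bdim m_)} {k : 'I_(t * s)} :
  reflect (submxblock (unvec x : 'M[R]_(bdim m_, bdim n_))
      (mxtens_unindex k).2 (mxtens_unindex k).1 = 0)
    (k \notin block_support x).
Proof. by rewrite inE mxE pnatr_eq0 eqb0 !negbK; exact: eqP. Qed.

Lemma block_support_segment {R : realType} {s t : nat} {m_ : 'I_s -> nat}
    {n_ : 'I_t -> nat} (x y : 'cV[R]_(bdim n_ * bdim m_)) (c : R) :
  block_support (x + c *: (y - x)) \subset block_support x :|: block_support y.
Proof.
apply/fintype.subsetP => k; apply: contraLR.
rewrite finset.in_setU negb_or.
move=> /andP[/block_supportPn x0 /block_supportPn y0].
apply/block_supportPn.
transitivity (submxblock (unvec x : 'M[R]_(bdim m_, bdim n_))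
    (mxtens_unindex k).2 (mxtens_unindex k).1 + c *: (submxblock
    (unvec y : 'M[R]_(bdim m_, bdim n_)) (mxtens_unindex k).2
    (mxtens_unindex k).1 - submxblock (unvec x : 'M[R]_(bdim m_, bdim n_))
    (mxtens_unindex k).2 (mxtens_unindex k).1)).
  by apply/matrixP => i j; rewrite !mxE.
by rewrite x0 y0 subrr scaler0 addr0.
Qed.

(** A nonzero block has a nonzero entry, which stays nonzero nearby. *)
Lemma block_support_near {R : realType} {s t : nat} {m_ : 'I_s -> nat}
    {n_ : 'I_t -> nat} (x : 'cV[R]_(bdim n_ * bdim m_)) :
  \forall y \near x, block_support x \subset block_support y.
Proof.
suff near_k (k : 'I_(t * s)) :
    \forall y \near x, k \in block_support x -> k \in block_support y.
  have := filter_forall (nbhs_filter x) near_k; apply: filterS => y xy.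
  by apply/fintype.subsetP => k; exact: xy.
have [kx|kx] := boolP (k \in block_support x); last first.
  by apply: (nearW (nbhs_filter x)).
have /matrix0Pn[i [j xij]] : submxblock (unvec x : 'M[R]_(bdim m_, bdim n_))
    (mxtens_unindex k).2 (mxtens_unindex k).1 != 0.
  by apply/eqP => /block_supportPn; rewrite kx.
rewrite !mxE in xij.
have := cvgr_neq0 (FF := nbhs_filter x) _ (@coord_continuous _ _ _ _ _ x) xij.
apply: filterS => y yij _; apply: contraNT yij => /block_supportPn y0.
by move/matrixP: y0 => /(_ i j); rewrite !mxE => ->.
Qed.

Theorem theorem1 (R : realType) (s t l q M : nat)
    (m_ : 'I_s -> nat) (n_ : 'I_t -> nat)
    (A : 'M[R]_(bdim n_)) (B1 : 'M[R]_(bdim n_, l))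
    (B2 : 'M[R]_(bdim n_, bdim m_))
    (C : 'M[R]_(q, bdim n_)) (D : 'M[R]_(q, bdim m_))
    (A_ : 'I_M -> 'M[R]_(bdim n_)) (B2_ : 'I_M -> 'M[R]_(bdim n_, bdim m_))
    (e : 'I_(@npairs t) -> 'I_t * 'I_t) (gamma : R)
    (sbar : 'cV[R]_(bdim n_ * bdim m_)) :
  let F_ := fun i => Fmx (A_ i) (B2_ i) in
  let phi1hat := phi1 e B1 C D F_ in
  let zetahat := zeta e B1 C D F_ gamma in
  enum_upper e ->
  0 < gamma ->
  standing1 A B1 B2 C D ->
  standing2 A B2 A_ B2_ ->
  ri (dom phi1hat) sbar ->
  limiting_subdiff zetahat sbar 0 ->
  local_minimizer zetahat sbar /\
  exists omega : {set 'I_(t * s)},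
    global_minimizer_on phi1hat
      [set s2 | forall i, i \notin omega -> bpi s2 i 0 = 0] sbar.
Proof.
move=> F_ phi1hat zetahat _ gamma0 _ _ ri_sbar stat.
have [loc_min [_ glob_min]] := stationary_support_penalized
  (econvex_phi1 e B1 C D F_) gamma0 block_support_segment
  (block_support_near sbar) ri_sbar stat.
split=> //; exists (block_support sbar); split=> [i|y y0].
  by rewrite inE negbK => /eqP.
apply: glob_min; apply/fintype.subsetP => i; apply: contraLR => /y0 yi.
by rewrite inE yi eqxx.
Qed.
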